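(* For any Hausdorff space $X$, $n\omega(\mathcal{S}(X))=cs\omega(X)$.
   Context: For a Hausdorff space $X$, $\mathcal{S}(X)$ is the set of all nonempty subsets of $X$ that are unions of finitely many convergent sequences of $X$, where a convergent sequence is understood as a set $\{x_j:j\in\mathbb{N}\}\cup\{x\}$ with $x_j\to x$ in $X$ (trivial, i.e. constant, sequences allowed). $\mathcal{S}(X)$ carries the Vietoris topology, whose basic open sets are $\langle U_1,\dots,U_r\rangle=\{S\in\mathcal{S}(X): S\subset\bigcup_{i=1}^r U_i \text{ and } S\cap U_j\neq\emptyset \text{ for } 1\le j\le r\}$ with $r\in\mathbb{N}$ and $U_1,\dots,U_r$ open in $X$. Let $Y$ be a space. A family $\mathcal{P}$ of subsets of $Y$ is a network if for each $y\in Y$ and any open neighborhood $U$ of $y$ there is $P\in\mathcal{P}$ with $y\in P\subset U$; the network weight is $n\omega(Y)=\aleph_0+\min\{|\mathcal{P}|:\mathcal{P}\text{ is a network of }Y\}$. A cover $\mathcal{P}=\bigcup_{y\in Y}\mathcal{P}_y$ of $Y$, where $y\in\bigcap\mathcal{P}_y$ for each $y$, is a cs-network of $Y$ if for each $y\in Y$ and every sequence $\{y_n\}$ converging to $y\in U$ with $U$ open in $Y$ there is $P\in\mathcal{P}_y$ such that $\{y_n\}$ is eventually in $P$ and $P\subset U$. Define $cs\omega(Y)=\aleph_0+\min\{|\mathcal{N}|:\mathcal{N}\text{ is a cs-network of }Y\}$. *)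

(* Defs.v *)
From HB Require Import structures.
From mathcomp Require Import all_boot.
From mathcomp Require Import boolp classical_sets functions cardinality.
From mathcomp Require Import topology.

Set Implicit Arguments.
Unset Strict Implicit.
Unset Printing Implicit Defensive.

Local Open Scope classical_set_scope.
Local Open Scope card_scope.

(* A member of F of least cardinality; by least_cardP it exists as soon as F is
   nonempty, and it is unique up to #= . *)
Definition least_card (T : Type) (F : set (set T)) : set T :=
  xget set0 [set A | F A /\ forall B, F B -> A #<= B].

(* The cardinal sum of aleph_0 and |A|, as a disjoint union. *)
Definition aleph0_plus (T : Type) (A : set T) : set (nat + T) :=
  [set inl n | n in [set: nat]] `|` [set inr a | a in A].

Lemma least_cardP (T : Type) (F : set (set T)) : F !=set0 ->
  F (least_card F) /\ forall B, F B -> least_card F #<= B.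
Proof.
move=> [A0 FA0].
suff [A FA minA] : exists2 A, F A & forall B, F B -> A #<= B.
  rewrite /least_card.
  exact: (@xgetPex _ set0 [set A | F A /\ forall B, F B -> A #<= B]
    (ex_intro _ A (conj FA minA))).
have [F0|F0] := pselect (F set0); first by exists set0 => // B _; exact: card_ge0.
have [t0 _] : A0 !=set0 by apply/set0P/eqP => A00; apply: F0; rewrite -A00.
pose P (G : set (set T -> T)) := (forall B g, F B -> G g -> B (g B)) /\
  (forall B g h, F B -> G g -> G h -> g B = h B -> g = h).
have [H HP Htot|G [[Gval Ginj] Gmax]] := @Zorn_bigcup _ P.
  split=> [B g FB [G HG Gg]|B g h FB [G HG Gg] [K HK Kh]].
    by have [v _] := HP _ HG; exact: v B g FB Gg.
  have [GK|KG] := Htot _ _ HG HK.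
    by have [_ i] := HP _ HK; apply: (i B) => //; exact: GK.
  by have [_ i] := HP _ HG; apply: (i B) => //; exact: KG.
have [[A FA surjA]|nsurj] :=
    pselect (exists2 A, F A & forall a, A a -> exists2 g, G g & g A = a).
  exists A => // B FB.
  have /choice[f fP] : forall a, exists g : set T -> T, A a -> G g /\ g A = a.
    move=> a; have [/surjA[g Gg gA]|nA] := pselect (A a); first by exists g.
    by exists (fun=> t0).
  have [g] : $|{injfun A >-> B}|.
    apply/injfunPex; exists (fun a => f a B) =>
      [a Aa|a b /set_mem Aa /set_mem Ab fab].
      by apply: (Gval B) => //; case: (fP _ Aa).
    have [Ga <-] := fP _ Aa; have [Gb <-] := fP _ Ab.
    by congr (_ A); exact: (Ginj B).
  exact: inj_card_le g.
have /choice[g gP] : forall B, exists b, F B -> B b /\ forall g, G g -> g B <> b.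
  move=> B.
  have [FB|nF] := pselect (F B); last by exists t0.
  apply: contrapT => nb; apply: nsurj; exists B => // b Bb.
  apply: contrapT => ng; apply: nb; exists b => _; split => // h Gh hB.
  by apply: ng; exists h.
exfalso; apply: (Gmax (G `|` [set g])).
  split=> [h Gh|]; first by left.
  by move=> /(_ g (or_intror erefl)) Gg; have [_ /(_ g Gg)] := gP _ FA0.
split=> [B h FB [Gh|->]|B h k FB]; first exact: (Gval B).
  by case: (gP _ FB).
have [_ gB] := gP _ FB.
case=> [Gh|->]; case=> [Gk|->] //; first exact: (Ginj B).
  by move/gB: Gh.
by move=> e; case: (gB k Gk).
Qed.

Section Networks.
Variable Y : topologicalType.

Definition is_network (P : set (set Y)) : Prop :=
  forall (y : Y) (U : set Y), open U -> U y ->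
  exists A, [/\ P A, A y & A `<=` U].

Definition is_cs_network (P : set (set Y)) : Prop :=
  \bigcup_(A in P) A = [set: Y] /\
  exists Py : Y -> set (set Y),
    [/\ P = \bigcup_y Py y,
        forall y A, Py y A -> A y &
        forall (y : Y) (u : nat -> Y) (U : set Y),
          u @ \oo --> y -> open U -> U y ->
          exists A, [/\ Py y A, \forall n \near \oo, A (u n) & A `<=` U]].

Definition network_weight : set (nat + set Y) :=
  aleph0_plus (least_card is_network).

Definition cs_weight : set (nat + set Y) :=
  aleph0_plus (least_card is_cs_network).

Lemma is_network_nonempty : is_network !=set0.
Proof. by exists setT => y U _ Uy; exists U; split. Qed.

Lemma is_cs_network_nonempty : is_cs_network !=set0.
Proof.
exists (\bigcup_y [set A : set Y | A y]); split.
  by apply/seteqP; split=> // y _; exists setT => //; exists y.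
exists (fun y => [set A : set Y | A y]); split=> // y u U uy oU Uy.
by exists U; split=> //; apply: uy; exact: open_nbhs_nbhs.
Qed.

End Networks.

Arguments network_weight : clear implicits.
Arguments cs_weight : clear implicits.

Section ConvSets.
Variable X : topologicalType.

Definition conv_seq_set (C : set X) : Prop :=
  exists (u : nat -> X) (x : X), u @ \oo --> x /\ C = range u `|` [set x].

Definition finite_union_conv_seq (S : set X) : Prop :=
  exists (n : nat) (C : 'I_n -> set X),
    (forall i, conv_seq_set (C i)) /\ S = \bigcup_i C i.

(* The hyperspace S(X). *)
Record conv_sets : Type := ConvSets {
  conv_set :> set X;
  conv_set_nonempty : conv_set !=set0;
  conv_set_finite_union : finite_union_conv_seq conv_set }.

Definition vietoris (r : nat) (U : 'I_r -> set X) : set conv_sets :=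
  [set S : conv_sets | (conv_set S `<=` \bigcup_i U i) /\
                       forall j, conv_set S `&` U j !=set0].

Definition vietoris_base : set (set conv_sets) :=
  [set W | exists (r : nat) (U : 'I_r -> set X),
    (forall i, open (U i)) /\ W = vietoris U].

Lemma vietoris_base_cover : \bigcup_(W in vietoris_base) W = [set: conv_sets].
Proof.
apply/seteqP; split=> // S _.
exists (vietoris (fun _ : 'I_1 => [set: X])).
  by exists 1, (fun=> setT); split=> // _; exact: openT.
split=> [x _|_]; first by exists ord0.
by rewrite setIT; exact: conv_set_nonempty.
Qed.

Lemma vietoris_base_join (W W' : set conv_sets) (S : conv_sets) :
  vietoris_base W -> vietoris_base W' -> W S -> W' S ->
  exists V, [/\ vietoris_base V, V S & V `<=` W `&` W'].
Proof.
move=> [r [U [oU ->]]] [s [U' [oU' ->]]] [SU SUj] [SU' SUj'].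
pose V (k : 'I_(r + s)) := match fintype.split k with
  | inl i => U i `&` \bigcup_j U' j
  | inr j => U' j `&` \bigcup_i U i end.
have Vl i : V (lshift s i) = U i `&` \bigcup_j U' j.
  by rewrite /V -[lshift s i]/(unsplit (inl i)) unsplitK.
have Vr j : V (rshift r j) = U' j `&` \bigcup_i U i.
  by rewrite /V -[rshift r j]/(unsplit (inr j)) unsplitK.
exists (vietoris V); split.
- exists (r + s), V; split=> // k; rewrite /V.
  by case: fintype.split => i; apply: openI => //; apply: bigcup_open => ? _.
- split=> [x Sx|k].
    have [i _ Uix] := SU _ Sx; exists (lshift s i) => //.
    by rewrite Vl; split=> //; exact: SU'.
  rewrite /V; case: fintype.split => i.
    by have [x [Sx Ux]] := SUj i; exists x; split=> //; split=> //; exact: SU'.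
  by have [x [Sx Ux]] := SUj' i; exists x; split=> //; split=> //; exact: SU.
- move=> T [TV TVj]; split; split.
  + move=> x /TV[k _]; rewrite /V; case: fintype.split => i [Ux //].
    by exists i.
  + by move=> j; have [x] := TVj (lshift s j); rewrite Vl => -[Tx [Ux _]]; exists x.
  + move=> x /TV[k _]; rewrite /V; case: fintype.split => i [Ux //].
    by exists i.
  + by move=> j; have [x] := TVj (rshift r j); rewrite Vr => -[Tx [Ux _]]; exists x.
Qed.

HB.instance Definition _ := gen_eqMixin conv_sets.
HB.instance Definition _ := gen_choiceMixin conv_sets.
HB.instance Definition _ := @isBaseTopological.Build conv_sets
  (set conv_sets) vietoris_base id vietoris_base_cover vietoris_base_join.

End ConvSets.

(* Main.v *)
Require Import Defs.
From mathcomp Require Import all_boot.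
From mathcomp Require Import boolp classical_sets functions cardinality.
From mathcomp Require Import topology.

Local Open Scope classical_set_scope.
Local Open Scope card_scope.

(** The key observation is that a finite family of convergent sequences is the
    same kind of data as a point of the hyperspace, so that networks on one
    side and cs-networks on the other can be traded for each other.

    From the hyperspace down to X ([cs_network_of_network]): if a sequence u
    converges to y in an open U, then some tail of u together with y is a
    point S of the basic open set <U>.  A network element squeezed between S
    and <U> is a collection of subsets of U, one of which is S; its union is a
    subset of U that contains y and a tail of u.  Hence the unions of the
    elements of a network form a cs-network, which is no larger.

    From X up to the hyperspace ([network_of_cs_network]): given
    S in <U_1, ..., U_r>, finitely many elements of a cs-network, all inside
    the union of the U_i, suffice to cover S: one element swallows a tail of
    each constituent sequence with its limit, and finitely many more take the
    remaining points.  Adding for each j one element inside U_j that meets S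
    gives a finite family whose Vietoris-type set <P_1, ..., P_k> lies between
    S and <U_1, ..., U_r>.  So the sets <P_1, ..., P_k>, which are indexed by
    the words over the cs-network, form a network.

    What remains is cardinal arithmetic: an infinite set has as many words as
    elements ([words_card_le]), proved by Zorn's lemma, so that neither passage
    increases the sum of the cardinality with aleph_0; the theorem then follows
    from the Cantor-Bernstein theorem. *)

(** * Words over an infinite set *)

Lemma card_le_injection (T U : Type) (A : set T) (B : set U) :
  B !=set0 -> A #<= B -> exists2 f : T -> U, set_fun A B f & set_inj A f.
Proof.
move=> [b Bb] AB; apply/injfunPex.
elim/Ppointed: U => U in B b Bb AB *; first by case: (no b).
exact/pcard_leP.
Qed.

Lemma injection_card_le {T U : Type} {A : set T} {B : set U} (f : T -> U) :
  set_fun A B f -> set_inj A f -> A #<= B.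
Proof.
move=> fAB finj.
have [g] : $|{injfun A >-> B}| by apply/injfunPex; exists f.
exact: inj_card_le g.
Qed.

Lemma card_le_total (T : Type) (A B : set T) : A #<= B \/ B #<= A.
Proof.
have [|+ minL] := @least_cardP T [set A; B]; first by exists A; left.
case=> eL; rewrite eL in minL; [left | right]; apply: minL.
- by right.
- by left.
Qed.

Definition words {T : eqType} (A : set T) : set (seq T) :=
  [set s | [set` s] `<=` A].

Section Words.
Variable T : eqType.
Implicit Types (A B C : set T) (s t : seq T).

Lemma words_nil A : words A [::].
Proof. by []. Qed.

Lemma words_cons A x s : words A (x :: s) <-> A x /\ words A s.
Proof.
split=> [As|[Ax As] y /=].
  split=> [|y ys]; apply: As; rewrite /= inE ?eqxx //.
  by rewrite ys orbT.
by rewrite inE => /orP[/eqP ->|] //; exact: As.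
Qed.

Lemma words_cat A s t : words A s -> words A t -> words A (s ++ t).
Proof. by move=> As At x /=; rewrite mem_cat => /orP[]; [exact: As|exact: At]. Qed.

Lemma words_sub A B : A `<=` B -> words A `<=` words B.
Proof. by move=> AB s As x /As/AB. Qed.

(** Once B can code its own words it absorbs any C that is not larger:
    a letter of B `|` C becomes a two-letter word over B, whose first letter
    records its origin.  Since all codes have the same length, a concatenation
    of codes can be cut back in a unique way. *)
Lemma words_setU_card_le B C : B !=set0 ->
  words B #<= B -> C #<= B -> words (B `|` C) #<= B.
Proof.
move=> B0 wB CB.
have [f fB finj] := card_le_injection _ _ _ _ B0 wB.
have [h hB hinj] := card_le_injection _ _ _ _ B0 CB.
pose c0 := f [::]; pose c1 := f [:: c0].
have Bc0 : B c0 by apply: fB; exact: words_nil.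
have Wc0 : words B [:: c0] by apply/words_cons; split.
have Bc1 : B c1 by exact: fB.
have c01 : c0 <> c1.
  by move/finj => /(_ (mem_set (words_nil B)) (mem_set Wc0)).
pose code x := if pselect (B x) then [:: c0; x] else [:: c1; h x].
have codeW x : (B `|` C) x -> words B (code x).
  rewrite /code; case: pselect => [Bx _|nBx [//|Cx]].
    by do 2 (apply/words_cons; split=> //).
  by do 2 (apply/words_cons; split=> //); exact: hB.
have codeinj x y s t : (B `|` C) x -> (B `|` C) y ->
    code x ++ s = code y ++ t -> x = y /\ s = t.
  rewrite /code; case: pselect => [Bx|nBx] + +; case: pselect => [By|nBy] //=.
  - by move=> _ _ [-> ->].
  - by move=> _ _ [].
  - by move=> _ _ [/esym].
  - move=> [//|Cx] [//|Cy] [hxy ->]; split=> //.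
    by apply: hinj => //; exact: mem_set.
pose codes s := flatten (map code s).
have codesW s : words (B `|` C) s -> words B (codes s).
  elim: s => [_|x s IH /words_cons[BCx /IH Bs]]; first exact: words_nil.
  by apply: words_cat => //; exact: codeW.
have codesinj s t : words (B `|` C) s -> words (B `|` C) t ->
    codes s = codes t -> s = t.
  elim: s t => [|x s IH] [|y t] //.
  - by move=> _ _; rewrite /codes /= /code; case: pselect.
  - by move=> _ _; rewrite /codes /= /code; case: pselect.
  - move=> /words_cons[BCx Ws] /words_cons[BCy Wt] /codeinj.
    by move=> /(_ BCx BCy)[-> /IH ->].
apply: (injection_card_le (f \o codes)) => [s Ws|s t /set_mem Ws /set_mem Wt].
  exact/fB/codesW.
move=> /finj e; apply: codesinj => //.
by apply: e; apply/mem_set; exact: codesW.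
Qed.

(** The objects to which Zorn's lemma is applied.  Nonemptiness is part of the
    structure because [words_setU_card_le] will be used for the alphabet of a
    maximal one. *)
Record coding A := Coding {
  alphabet : set T;
  encode : seq T -> T;
  alphabet_sub : alphabet `<=` A;
  alphabet_neq0 : alphabet !=set0;
  encode_fun : set_fun (words alphabet) alphabet encode;
  encode_inj : set_inj (words alphabet) encode }.

Arguments alphabet {A}.
Arguments encode {A}.

Definition extends A (p q : coding A) : bool :=
  `[< alphabet p `<=` alphabet q /\
      forall s, words (alphabet p) s -> encode p s = encode q s >].

Lemma extends_refl A (p : coding A) : extends A p p.
Proof. by apply/asboolP; split. Qed.

Lemma extends_trans A (p q r : coding A) :
  extends A p q -> extends A q r -> extends A p r.
Proof.
move=> /asboolP[pq epq] /asboolP[qr eqr]; apply/asboolP.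
split=> [|s Ws]; first exact: subset_trans qr.
by rewrite epq // eqr //; exact: words_sub Ws.
Qed.

(** Words over a countable set are coded by the pickling of lists of natural
    numbers. *)
Lemma coding_exists A : infinite_set A -> inhabited (coding A).
Proof.
move=> infA.
have [e eA einj] := card_le_injection _ _ _ _ (infinite_setN0 infA)
  (proj1 (infiniteP A) infA).
have /choice[g ge] : forall x, exists n, range e x -> e n = x.
  move=> x; have [[n _ enx]|nx] := pselect (range e x); first by exists n.
  by exists 0.
have mapK s : words (range e) s -> map e (map g s) = s.
  elim: s => //= x s IH /words_cons[ex Ws].
  by rewrite ge // IH.
constructor; apply: (@Coding A (range e) (fun s => e (pickle (map g s)))).
- by move=> _ [n _ <-]; exact: eA.
- by exists (e 0), 0.
- by move=> s _; exists (pickle (map g s)).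
- move=> s t /set_mem Ws /set_mem Wt est.
  rewrite -(mapK s Ws) -(mapK t Wt); congr map.
  apply: (pcan_inj (@pickleK _)); apply: einj => //; exact/mem_set.
Qed.

(** A word is finite, so its letters already lie in one member of a chain;
    the members that contain them agree on its code. *)
Lemma chain_coding A (K : set (coding A)) : K !=set0 ->
  total_on K (fun p q => extends A p q) ->
  exists q, forall p, K p -> extends A p q.
Proof.
move=> [p0 Kp0] totK.
pose B := \bigcup_(p in K) alphabet p.
have wordK s : words B s -> exists2 p, K p & words (alphabet p) s.
  elim: s => [_|x s IH /words_cons[[p Kp px] /IH[q Kq qs]]].
    by exists p0 => //; exact: words_nil.
  have [/asboolP[pq _]|/asboolP[qp _]] := totK _ _ Kp Kq.
    by exists q => //; apply/words_cons; split=> //; exact: pq.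
  by exists p => //; apply/words_cons; split=> //; exact: words_sub qs.
have /choice[k kP] : forall s, exists p,
    words B s -> K p /\ words (alphabet p) s.
  move=> s; have [/wordK[p Kp ps]|nBs] := pselect (words B s); first by exists p.
  by exists p0.
have agree p q s : K p -> K q -> words (alphabet p) s -> words (alphabet q) s ->
    encode p s = encode q s.
  move=> Kp Kq ps qs.
  by have [/asboolP[_ ->]|/asboolP[_ ->]] := totK _ _ Kp Kq.
pose F s := encode (k s) s.
have BA : B `<=` A by move=> x [p _ /alphabet_sub].
have B0 : B !=set0.
  by have [x p0x] := alphabet_neq0 _ p0; exists x, p0.
have FB : set_fun (words B) B F.
  by move=> s /kP[Kk ks]; exists (k s) => //; exact: encode_fun.
have Finj : set_inj (words B) F.
  move=> s t /set_mem Bs /set_mem Bt; rewrite /F.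
  have [Ks ks] := kP _ Bs; have [Kt kt] := kP _ Bt.
  have [/asboolP[st _]|/asboolP[ts _]] := totK _ _ Ks Kt.
    have kts : words (alphabet (k t)) s by exact: words_sub ks.
    rewrite (agree _ (k t)) // => /encode_inj; apply; exact/mem_set.
  have kst : words (alphabet (k s)) t by exact: words_sub kt.
  rewrite (agree (k t) (k s)) // => /encode_inj; apply; exact/mem_set.
exists (Coding A B F BA B0 FB Finj) => p Kp; apply/asboolP.
have pB : alphabet p `<=` B by move=> x px; exists p.
split=> //= s ps; have [Kk ks] := kP _ (words_sub _ _ pB _ ps).
exact: agree.
Qed.

(** Take a maximal coding, with alphabet B.  If B embedded into A `\` B, with
    image C, then the words over B `|` C that are not words over B could be
    coded by elements of C, contradicting maximality.  So A `\` B embeds into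
    B, and B absorbs it. *)
Theorem words_card_le A : infinite_set A -> words A #<= A.
Proof.
move=> infA; have [p0] := coding_exists A infA.
have [|[B f BA B0 fB finj] Bmax] := ZL_preorder p0 (extends_refl A)
    (fun q p r => extends_trans A q p r).
  move=> K totK; have [->|/set0P K0] := eqVneq K set0; first by exists p0.
  exact: chain_coding.
have wB : words B #<= B by exact: (injection_card_le f).
have [le|ge] := card_le_total _ (A `\` B) B.
  have -> : words A = words (B `|` (A `\` B)).
    by rewrite setDUK.
  apply: card_le_trans (subset_card_le BA).
  exact: words_setU_card_le.
have [b Bb] := B0.
have AB0 : (A `\` B) !=set0.
  apply/set0P/eqP => e; move: ge; rewrite e card_le0 => /eqP Be.
  by rewrite Be in Bb.
have [h hAB hinj] := card_le_injection _ _ _ _ AB0 ge.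
pose C := h @` B.
have CB : C #<= B by exact: card_image_le.
have BC : B #<= C.
  by apply: (injection_card_le h) => // x Bx; exists x.
have C0 : C !=set0 by exists (h b), b.
have CAB : C `<=` A `\` B by move=> _ [x Bx <-]; exact: hAB.
have [g gC ginj] := card_le_injection _ _ _ _ C0
  (card_le_trans (words_setU_card_le _ _ B0 wB CB) BC).
pose f' s := if pselect (words B s) then f s else g s.
have BCA : B `|` C `<=` A by move=> x [/BA //|/CAB[]].
have BC0 : (B `|` C) !=set0 by exists b; left.
have f'BC : set_fun (words (B `|` C)) (B `|` C) f'.
  move=> s Ws; rewrite /f'; case: pselect => [Bs|nBs]; first by left; exact: (fB s).
  by right; exact: gC.
have f'inj : set_inj (words (B `|` C)) f'.
  have fg s t : words B s -> words (B `|` C) t -> f s <> g t.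
    by move=> /fB Bfs /gC/CAB[_ nB] e; apply: nB; rewrite -e.
  move=> s t /set_mem Ws /set_mem Wt; rewrite /f'.
  case: pselect => [Bs|nBs]; case: pselect => [Bt|nBt].
  - by apply: (finj s t); exact/mem_set.
  - by move/fg => /(_ Bs Wt).
  - by move/esym/fg => /(_ Bt Ws).
  - by apply: ginj; exact/mem_set.
have /Bmax/asboolP[BCB _] : extends A (Coding A B f BA B0 fB finj)
    (Coding A (B `|` C) f' BCA BC0 f'BC f'inj).
  apply/asboolP; split=> [x Bx|s Ws] /=; first by left.
  by rewrite /f'; case: pselect.
have [c Cc] := C0; have [_ []] := CAB _ Cc.
by apply: BCB; right.
Qed.

End Words.

Lemma aleph0_plus_infinite {T : Type} (A : set T) :
  infinite_set (aleph0_plus A).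
Proof.
apply/infiniteP; apply: (injection_card_le inl) => [n _|m n _ _ [] //].
by left; exists n.
Qed.

Lemma card_le_aleph0_plus {T : Type} (A : set T) : A #<= aleph0_plus A.
Proof.
apply: (injection_card_le inr) => [a Aa|a b _ _ [] //].
by right; exists a.
Qed.

(** Both summands inject into the words over C, the first in words of length
    one, the second in words of length two. *)
Lemma aleph0_plus_card_le {T : Type} {U : eqType} (A : set T) (C : set U) :
  infinite_set C -> A #<= C -> aleph0_plus A #<= C.
Proof.
move=> infC AC; apply: card_le_trans (words_card_le _ C infC).
have C0 := infinite_setN0 infC.
have [e eC einj] := card_le_injection _ _ _ _ C0 (proj1 (infiniteP C) infC).
have [g gC ginj] := card_le_injection _ _ _ _ C0 AC.
pose F x := match x with inl n => [:: e n] | inr a => [:: g a; g a] end.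
apply: (injection_card_le F) => [_ [[n _ <-]|[a Aa <-]]|] /=.
- by apply/words_cons; split=> //; exact: eC.
- by do 2 (apply/words_cons; split; first exact: gC).
move=> x y /set_mem[[m _ <-]|[a Aa <-]] /set_mem[[n _ <-]|[b Bb <-]] //= [].
  by move/einj => -> //; exact/mem_set.
by move/ginj => -> //; exact/mem_set.
Qed.

Lemma words_card_le_aleph0_plus {T : choiceType} (A : set T) :
  words A #<= aleph0_plus A.
Proof.
apply: card_le_trans (words_card_le _ _ (aleph0_plus_infinite A)).
apply: (injection_card_le (map inr)) => [s|s t _ _].
  elim: s => [|x s IH] /=; first by move=> _; exact: words_nil.
  move=> /words_cons[Ax /IH Ws]; apply/words_cons; split=> //.
  by right; exists x.
by apply: inj_map => x y [].
Qed.

(** * From networks of the hyperspace to cs-networks *)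

Section Hyperspace.
Variable X : topologicalType.
Implicit Types (P : set (set X)) (V C : set X) (s : seq (set X)).

Lemma vietoris_open (r : nat) (U : 'I_r -> set X) :
  (forall i, open (U i)) -> open (vietoris U).
Proof.
move=> oU; exists [set vietoris U]; last by rewrite bigcup_set1.
by move=> _ ->; exists r, U.
Qed.

Lemma open_vietoris (W : set (conv_sets X)) (S : conv_sets X) :
  open W -> W S -> exists (r : nat) (U : 'I_r -> set X),
    [/\ forall i, open (U i), vietoris U S & vietoris U `<=` W].
Proof.
move=> [D DB <-] [B DB' BS]; have [r [U [oU eB]]] := DB _ DB'.
rewrite /= eB in BS; exists r, U; split=> // S' US'.
by exists B => //; rewrite /= eB.
Qed.

Lemma cvg_shift (u : nat -> X) (x : X) (m : nat) :
  u @ \oo --> x -> (fun n => u (n + m)) @ \oo --> x.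
Proof.
move=> ux V /ux[N _ NV]; exists N => // n /= Nn; apply: NV => /=.
exact: leq_trans (leq_addr _ _).
Qed.

Lemma cs_network_of_network (N : set (set (conv_sets X))) :
  is_network N -> exists2 P : set (set X), is_cs_network P & P #<= N.
Proof.
move=> netN.
pose flat (A : set (conv_sets X)) := \bigcup_(S in A) conv_set S.
(* The empty set is left out: every member of a cs-network has a base point. *)
pose P := [set flat A | A in N] `&` [set B | B !=set0].
have csP (y : X) (u : nat -> X) (U : set X) : u @ \oo --> y -> open U -> U y ->
    exists A, [/\ (P `&` [set A | A y]) A, \forall n \near \oo, A (u n) &
                  A `<=` U].
  move=> uy oU Uy.
  (* All terms from m on lie in U; together with y they form a point of <U>. *)
  have [m _ mU] : \forall n \near \oo, U (u n).
    by apply: uy; exact: open_nbhs_nbhs.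
  pose C := range (fun n => u (n + m)) `|` [set y].
  have C0 : C !=set0 by exists y; right.
  have CS : finite_union_conv_seq C.
    exists 1, (fun=> C); split=> [_|].
      by exists (fun n => u (n + m)), y; split=> //; exact: cvg_shift.
    by apply/seteqP; split=> [x Cx|x [_ _ //]]; exists ord0.
  have CU : vietoris (fun _ : 'I_1 => U) (ConvSets C0 CS).
    split=> [_ [[n _ <-]|->]|_] /=.
    - by exists ord0 => //; apply: mU => /=; exact: leq_addl.
    - by exists ord0.
    - by exists y; split=> //; right.
  have [|A [NA AC AU]] := netN _ _ _ CU; first exact: vietoris_open.
  have Ay : flat A y by exists (ConvSets C0 CS) => //=; right.
  exists (flat A); split.
  - by split=> //; split; [exists A|exists y].
  - exists m => // n /= mn; exists (ConvSets C0 CS) => //=.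
    by left; exists (n - m) => //; rewrite subnK.
  - by move=> x [S /AU[SU _] /SU[]].
exists P; last first.
  apply: card_le_trans (card_image_le flat N).
  by apply: subset_card_le => A [].
split.
  apply/seteqP; split=> // y _.
  have [A [[PA Ay] _ _]] :=
    csP y (fun=> y) setT (cvg_cst y) openT I.
  by exists A.
exists (fun y => P `&` [set A | A y]); split=> //.
  apply/seteqP; split=> [A PA|A [y _ [] //]].
  by have [_ [y Ay]] := PA; exists y.
by move=> y A [].
Qed.

(** * From cs-networks to networks of the hyperspace *)

(** What a word s over P has to satisfy for the collection of all sets that are
    covered by s and meet its letters to lie between C and the subsets of V. *)
Definition captures P V C s := [/\ words P s,
  C `<=` \bigcup_(A in [set` s]) A &
  forall A, A \in s -> C `&` A !=set0 /\ A `<=` V].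

Lemma captures_bigcup P V (n : nat) (C : 'I_n -> set X) :
  (forall i, exists s, captures P V (C i) s) ->
  exists s, captures P V (\bigcup_i C i) s.
Proof.
move=> /choice[s sP]; exists (flatten [seq s i | i <- enum 'I_n]); split.
- by move=> A /flatten_mapP[i _ Ai]; have [Ps _ _] := sP i; exact: Ps.
- move=> x [i _ Cx]; have [_ Cs _] := sP i; have [A Ai Ax] := Cs _ Cx.
  by exists A => //=; apply/flatten_mapP; exists i; rewrite ?mem_enum.
- move=> A /flatten_mapP[i _ Ai]; have [_ _ /(_ _ Ai)[[x [Cx Ax]] AV]] := sP i.
  by split=> //; exists x; split=> //; exists i.
Qed.

Lemma captures_setU P V C C' s s' :
  captures P V C s -> captures P V C' s' -> captures P V (C `|` C') (s ++ s').
Proof.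
move=> [Ps Cs sV] [Ps' Cs' sV']; split; first exact: words_cat.
- by move=> x [/Cs|/Cs'] [A /= As Ax]; exists A; rewrite //= mem_cat As ?orbT.
- move=> A; rewrite mem_cat => /orP[/sV|/sV'] [[x [Cx Ax]] AV].
    by split=> //; exists x; split=> //; left.
  by split=> //; exists x; split=> //; right.
Qed.

Lemma captures_tail P V (u : nat -> X) (x : X) : is_cs_network P ->
  open V -> V x -> u @ \oo --> x ->
  exists m s, captures P V (range (fun n => u (n + m)) `|` [set x]) s.
Proof.
move=> [_ [Py [eP Pyx csP]]] oV Vx ux.
have [A [PA [m _ mA] AV]] := csP _ _ _ ux oV Vx.
exists m, [:: A]; split.
- by apply/words_cons; split=> //; rewrite eP; exists x.
- move=> y Cy; exists A; first by rewrite /= inE.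
  case: Cy => [[n _ <-]|->]; last exact: Pyx PA.
  by apply: mA => /=; exact: leq_addl.
- move=> B; rewrite inE => /eqP ->; split=> //.
  by exists x; split; [right|exact: Pyx PA].
Qed.

Lemma captures_point P V (x : X) : is_cs_network P -> open V -> V x ->
  exists s, captures P V [set x] s.
Proof.
move=> csP oV Vx.
have [m [s]] := captures_tail P V (fun=> x) x csP oV Vx (cvg_cst x).
suff -> : [set x | _ in [set: nat]] `|` [set x] = [set x] by exists s.
by apply/seteqP; split=> [y [[_ _ <-]|]//|y ->]; right.
Qed.

Lemma captures_conv_seq P V C : is_cs_network P -> open V ->
  conv_seq_set C -> C `<=` V -> exists s, captures P V C s.
Proof.
move=> csP oV [u [x [ux ->]]] CV.
(* One letter for the tail and the limit, one for each of the first m terms. *)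
have [|m [s sP]] := captures_tail P V u x csP oV _ ux; first by apply: CV; right.
have [|t tP] := captures_bigcup P V m (fun i => [set u i]).
  by move=> i; apply: captures_point => //; apply: CV; left; exists i.
exists (s ++ t); have := captures_setU _ _ _ _ _ _ sP tP.
set D := (D in captures _ _ D _); suff -> : D = range u `|` [set x] by [].
apply/seteqP; split=> [y|y].
  case=> [[[n _ <-]|->]|[i _ ->]]; first by left; exists (n + m).
    by right.
  by left; exists i.
case=> [[n _ <-]|->]; last by left; right.
have [nm|mn] := ltnP n m; first by right; exists (Ordinal nm).
by left; left; exists (n - m) => //; rewrite subnK.
Qed.

(** The analogue of [vietoris] for a finite family of arbitrary sets. *)
Definition hit s : set (conv_sets X) :=
  [set S | conv_set S `<=` \bigcup_(A in [set` s]) A /\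
           forall A, A \in s -> conv_set S `&` A !=set0].

Lemma network_of_cs_network P :
  is_cs_network P ->
  exists2 N : set (set (conv_sets X)), is_network N & N #<= words P.
Proof.
move=> csP; exists [set hit s | s in words P]; last exact: card_image_le.
move=> S W oW WS; have [r [U [oU [SU SUj] UW]]] := open_vietoris _ _ oW WS.
pose V := \bigcup_i U i.
have oV : open V by apply: bigcup_open.
have [n [C [convC eS]]] := conv_set_finite_union S.
have [s0 [Ps0 Ss0 s0V]] : exists s, captures P V (conv_set S) s.
  rewrite eS; apply: captures_bigcup => i.
  apply: captures_conv_seq => // x Cx; apply: SU.
  by rewrite eS; exists i.
(* s0 ensures that S is covered inside V; the letters t j, which cover a point
   y j of S inside U j, ensure that U j is met. *)
have /choice[y yP] := SUj.
have /choice[t tP] : forall j, exists s, captures P (U j) [set y j] s.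
  by move=> j; apply: captures_point => //; case: (yP j).
pose s := s0 ++ flatten [seq t j | j <- enum 'I_r].
have tsub j A : A \in t j -> A \in s.
  move=> At; rewrite mem_cat; apply/orP; right.
  by apply/flatten_mapP; exists j; rewrite ?mem_enum.
have sP A : A \in s -> [/\ P A, conv_set S `&` A !=set0 & A `<=` V].
  rewrite mem_cat => /orP[As|/flatten_mapP[j _ At]].
    by have [] := s0V _ As; split=> //; exact: Ps0.
  have [Pt _ /(_ _ At)[[x [-> Ax]] AU]] := tP j; split; first exact: Pt.
    by exists (y j); split=> //; case: (yP j).
  by move=> z /AU Uz; exists j.
exists (hit s); split.
- by exists s => // A /sP[].
- split=> [x /Ss0[A As Ax]|A /sP[] //].
  by exists A => //=; rewrite mem_cat As.
- move=> S' [S's S'A]; apply: UW; split=> [x /S's[A /sP[_ _ AV] /AV] //|j].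
  have [_ /(_ _ erefl)[A At _] /(_ _ At)[_ AU]] := tP j.
  have [x [S'x Ax]] := S'A _ (tsub _ _ At).
  by exists x; split=> //; exact: AU.
Qed.

End Hyperspace.

(** * The equality *)

Theorem theorem4p25 (X : topologicalType) (hX : hausdorff_space X) :
  network_weight (conv_sets X) #= cs_weight X.
Proof.
have [netN minN] := least_cardP (@is_network_nonempty (conv_sets X)).
have [csP minP] := least_cardP (@is_cs_network_nonempty X).
rewrite /network_weight /cs_weight card_eq_le; apply/andP; split;
  apply: aleph0_plus_card_le; try exact: aleph0_plus_infinite.
- have [N /minN lN NP] := network_of_cs_network _ _ csP.
  apply: card_le_trans lN _; apply: card_le_trans NP _.
  exact: words_card_le_aleph0_plus.
- have [P /minP lP PN] := cs_network_of_network _ _ netN.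
  apply: card_le_trans lP _; apply: card_le_trans PN _.
  exact: card_le_aleph0_plus.
Qed.
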